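(* Let $n\ge 1$ be an integer and let $\lambda_0,\lambda_1,\lambda_2\in\mathbb{C}$ be such that all the zeros of $u(z)=\lambda_0+\binom{n}{1}\lambda_1 z+\binom{n}{2}\lambda_2 z^2$ lie in the half plane $\{z\in\mathbb{C}: |z|\le |z-\tfrac n2|\}$. Let $B$ be the associated operator on polynomials of degree at most $n$, $B[P(z)]=\lambda_0P(z)+\lambda_1\left(\frac{nz}{2}\right)\frac{P'(z)}{1!}+\lambda_2\left(\frac{nz}{2}\right)^2\frac{P''(z)}{2!}$. If $P(z)$ is a polynomial of degree $n$ with complex coefficients and $Q(z)=z^n\overline{P(1/\bar z)}$, then for all real or complex numbers $\alpha,\beta$ with $|\alpha|\le 1$, $|\beta|\le 1$, every real $R\ge 1$ and every $z\in\mathbb{C}$ with $|z|\ge 1$, $$\left|B[P(Rz)]-\alpha B[P(z)]+\beta\left\{\left(\frac{R+1}{2}\right)^n-|\alpha|\right\}B[P(z)]\right|+\left|B[Q(Rz)]-\alpha B[Q(z)]+\beta\left\{\left(\frac{R+1}{2}\right)^n-|\alpha|\right\}B[Q(z)]\right|$$ $$\le\left[\left|R^n-\alpha+\beta\left\{\left(\frac{R+1}{2}\right)^n-|\alpha|\right\}\right||B[z^n]|+\left|1-\alpha+\beta\left\{\left(\frac{R+1}{2}\right)^n-|\alpha|\right\}\right||\lambda_0|\right]\max_{|w|=1}|P(w)|.$$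
   Context: $B$ is applied to polynomials in the variable $z$: $B[P(Rz)]$ denotes the result of applying $B$ to the polynomial $z\mapsto P(Rz)$, evaluated at $z$ (so derivatives are taken with respect to $z$), and similarly for $B[Q(Rz)]$; $B[z^n]$ denotes $B$ applied to the monomial $z^n$, evaluated at $z$. The integer $n$ in the definitions of $B$ and of $Q$ is the degree of $P$. $Q$ is regarded as a polynomial (of degree at most $n$): if $P(z)=\sum_{k=0}^n a_kz^k$ then $Q(z)=\sum_{k=0}^n\overline{a_k}z^{n-k}$. *)

(* Defs.v *)
From mathcomp Require Import all_boot all_order all_algebra.
From mathcomp Require Import complex.
From mathcomp Require Import all_classical all_reals all_analysis.

Set Implicit Arguments.
Unset Strict Implicit.
Unset Printing Implicit Defensive.

Import Order.TTheory GRing.Theory Num.Theory.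
Import numFieldNormedType.Exports.

Local Open Scope classical_set_scope.
Local Open Scope complex_scope.
Local Open Scope ring_scope.

Section Operators.
Variable F : numClosedFieldType.
Implicit Types (P : {poly F}) (r z : F).

Definition upoly (n : nat) (l0 l1 l2 : F) : {poly F} :=
  l0%:P + ('C(n, 1)%:R * l1) *: 'X + ('C(n, 2)%:R * l2) *: 'X^2.

Definition Bop (n : nat) (l0 l1 l2 : F) P : {poly F} :=
  l0 *: P
  + l1 *: (((n%:R / 2) *: 'X) * ((1`!)%:R^-1 *: P^`(1)))
  + l2 *: (((n%:R / 2) *: 'X) ^+ 2 * ((2`!)%:R^-1 *: P^`(2))).

Definition dilate r P : {poly F} := P \Po (r *: 'X).

(* z^n * conj (P (1 / conj z)) as a polynomial, for P of degree at most n;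
   see [horner_conj_recip]. *)
Definition conj_recip (n : nat) P : {poly F} :=
  \sum_(k < n.+1) (P`_k)^* *: 'X^(n - k).

Lemma horner_dilate r P z : (dilate r P).[z] = P.[r * z].
Proof. by rewrite horner_comp hornerZ hornerX. Qed.

Lemma horner_conj_recip n P z : (size P <= n.+1)%N -> z != 0 ->
  (conj_recip n P).[z] = z ^+ n * (P.[(z^*)^-1])^*.
Proof.
move=> sP z0; rewrite (horner_coef_wide _ sP) rmorph_sum mulr_sumr horner_sum.
apply: eq_bigr => k _; rewrite hornerZ hornerXn rmorphM rmorphXn /= fmorphV /=.
rewrite conjCK mulrCA; congr (_ * _).
by rewrite exprVn expfB_cond // (negPf z0) /= -ltnS ltn_ord.
Qed.

End Operators.

(* The supremum is attained, so this is max_{|w| = 1} |P(w)|;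
   see [circle_max_attained] and [circle_max_ub]. *)
Definition circle_max (R : realType) (P : {poly R[i]}) : R :=
  sup [set Normc.normc P.[w] | w in [set w : R[i] | `|w| = 1]].

Section CircleMax.
Variable R : realType.
Implicit Types (P : {poly R[i]}) (t : R) (w : R[i]).

Let cis t : R[i] := cos t +i* sin t.

Let normc_cis t : `|cis t| = 1.
Proof. by rewrite normc_def /= cos2Dsin2 sqrtr1. Qed.

Let cis_surj w : `|w| = 1 -> exists2 t, t \in `[- pi, pi] & cis t = w.
Proof.
case: w => a b; rewrite normc_def /= => -[ab1].
have ab : a ^+ 2 + b ^+ 2 = 1.
  rewrite -(@sqr_sqrtr _ (a ^+ 2 + b ^+ 2)) ?ab1 ?expr1n //.
  by rewrite addr_ge0 ?sqr_ge0.
have a1 : -1 <= a <= 1.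
  by rewrite -ler_norml -(@expr_le1 _ 2) // real_normK ?num_real // -ab lerDl sqr_ge0.
have sb : Num.sqrt (1 - a ^+ 2) = `|b| by rewrite -ab addrC addKr sqrtr_sqr.
have [b0|b0] := leP 0 b.
  exists (acos a).
    by rewrite in_itv /= acos_lepi // (le_trans _ (acos_ge0 a1)) // oppr_le0 pi_ge0.
  by rewrite /cis acosK // sin_acos // sb ger0_norm.
exists (- acos a).
  rewrite in_itv /= lerN2 acos_lepi //= (le_trans _ (pi_ge0 R)) //.
  by rewrite oppr_le0 acos_ge0.
by rewrite /cis cosN sinN acosK // sin_acos // sb ltr0_norm // opprK.
Qed.

Let horner_cis_continuous P :
  continuous (fun t => complex.Re P.[cis t]) /\
  continuous (fun t => complex.Im P.[cis t]).
Proof.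
elim/poly_ind: P => [|p c [cR cI]].
  by split=> t; under eq_fun do rewrite horner0 /=; exact: cvg_cst.
have E t : p.[cis t] * cis t + c =
    (complex.Re p.[cis t] * cos t - complex.Im p.[cis t] * sin t
       + complex.Re c) +i*
    (complex.Re p.[cis t] * sin t + complex.Im p.[cis t] * cos t
       + complex.Im c).
  by case: (p.[cis t]) c => a b [a' b'].
have cos_c : continuous (@cos R) by exact: continuous_cos.
have sin_c : continuous (@sin R) by exact: continuous_sin.
split=> t; under eq_fun do rewrite hornerMXaddC E /=.
  apply: cvgD; last exact: cvg_cst.
  by apply: cvgB; apply: cvgM; [exact: cR|exact: cos_c|exact: cI|exact: sin_c].
apply: cvgD; last exact: cvg_cst.
by apply: cvgD; apply: cvgM; [exact: cR|exact: sin_c|exact: cI|exact: cos_c].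
Qed.

Let circle_attains P : exists2 w0 : R[i], `|w0| = 1 &
  forall w, `|w| = 1 -> Normc.normc P.[w] <= Normc.normc P.[w0].
Proof.
have [cR cI] := horner_cis_continuous P.
pose g t := Num.sqrt (complex.Re P.[cis t] ^+ 2 + complex.Im P.[cis t] ^+ 2).
have gE t : Normc.normc P.[cis t] = g t by rewrite /g; case: (P.[cis t]).
have cg : continuous g.
  move=> t; apply: continuous_comp; last exact: sqrt_continuous.
  by apply: cvgD; apply: cvgM; [exact: cR|exact: cR|exact: cI|exact: cI].
have pi2 : (- pi : R) <= pi by rewrite ge0_cp // pi_ge0.
have [t0 _ tmax] := EVT_max pi2 (continuous_subspaceT cg).
exists (cis t0); first exact: normc_cis.
by move=> w /cis_surj[t tpi <-]; rewrite !gE; exact: tmax.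
Qed.

Lemma circle_max_attained P :
  exists2 w0 : R[i], `|w0| = 1 & Normc.normc P.[w0] = circle_max P.
Proof.
have [w0 w01 wmax] := circle_attains P; exists w0 => //.
apply/esym/le_anti/andP; split.
  apply: ge_sup; first by exists (Normc.normc P.[w0]), w0.
  by move=> _ [w w1 <-]; exact: wmax.
apply: ub_le_sup; last by exists w0.
by exists (Normc.normc P.[w0]) => _ [w w1 <-]; exact: wmax.
Qed.

Lemma circle_max_ub P w : `|w| = 1 -> Normc.normc P.[w] <= circle_max P.
Proof.
have [w0 w01 wmax] := circle_attains P => w1.
apply: ub_le_sup; last by exists w.
by exists (Normc.normc P.[w0]) => _ [v v1 <-]; exact: wmax.
Qed.

End CircleMax.

(* Main.v *)
From HB Require Import structures.
Require Import Defs.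
From mathcomp Require Import all_boot all_order all_algebra.
From mathcomp Require Import complex.
From mathcomp Require Import all_classical all_reals all_analysis.
From mathcomp Require Import ring zify.
From mathcomp Require cyclic separable cyclotomic.

Set Implicit Arguments.
Unset Strict Implicit.
Unset Printing Implicit Defensive.

Import Order.TTheory GRing.Theory Num.Theory.

Local Open Scope complex_scope.
Local Open Scope ring_scope.

(** Fix $z$ with $|z| \ge 1$, put $d = a - c$, and consider the linear functional
    $L(F) = B[F(R\cdot) - d F](z)$ on polynomials of degree at most $n$.  Both
    terms on the left of the inequality have the form $|L(F)|$, for $F = P$ and
    $F = Q$, while $L(z^n) = (R^n - d) B[z^n]$ and $L(1) = (1 - d)\lambda_0$.

    The only property of $L$ that matters is that it does not vanish on a stable
    polynomial, that is, on a polynomial of degree $n$ with all its zeros in the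
    open unit disc.  Indeed let $|P| \le M$ on the unit disc and $|v| > M$.  Then
    $P + v$ has no zero in the closed disc, so its reciprocal
    $H = Q + \bar v z^n$ is stable; moreover $|P + v| \le |H|$ outside the disc
    (compare the two products factor by factor), so that $P + v - u H$ is stable
    whenever $|u| > 1$.  As $L$ vanishes on none of these polynomials,
    $|L(P) + v L(1)| \le |L(Q) + \bar v L(z^n)|$.  Choosing the argument of $v$ so
    that the right-hand side is $|v| |L(z^n)| - |L(Q)|$ and letting $|v|$ decrease
    to $M$ gives $|L(P)| + |L(Q)| \le (|L(z^n)| + |L(1)|) M$: this is
    [scalar_stable_bound].

    That $L$ does not vanish on stable polynomials has two reasons.

    - If $F$ is stable and $R > 1$ then $|F(Rx)| > ((R+1)/2)^n |F(x)|$ for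
      $|x| \ge 1$, again factor by factor, and $|d| \le ((R+1)/2)^n$; hence
      $F(R\cdot) - d F$ is stable ([stable_dilate]).

    - $B[F](z) \ne 0$ for stable $F$ ([Bop_stable_neq0]).  Split $u$ into two
      linear factors $p + q w$.  For fixed $z$ and $n \ge 2$, $n(n-1) B[F](z)$ is
      the value at $z$ of the polynomial obtained from $F$ by two successive polar derivatives,
      one per factor, and the hypothesis on the zeros of $u$ says precisely that
      the poles of these derivatives lie outside the open disc.  Laguerre's
      theorem ([stable_polar]) then shows that each of them preserves stability.

    For $R = 1$ the factor $1 - d$ comes out of every term, and the bound for
    $d = 0$ is enough.  The passage from the unit circle to the unit disc is the
    maximum modulus principle, proved for polynomials by estimating the
    coefficients of the powers of $P$ ([max_modulus_disc]). *)

Section Stable.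
Variable C : numClosedFieldType.
Implicit Types (F G H P : {poly C}) (A B M R d p q u v w x r z : C) (s : seq C).

(** * Stable polynomials *)

Definition stable n F := size F = n.+1 /\ forall x, 1 <= `|x| -> F.[x] != 0.

(** [dilate_norm_gt] and [reflect_norm_le] compare moduli through an identity that
    writes the difference of their squares as a sum of visibly nonnegative terms. *)
Lemma ltr_norm_mulC x z : x * x^* < z * z^* -> `|x| < `|z|.
Proof. by rewrite -!normCK ltr_pXn2r // nnegrE. Qed.

Lemma ler_norm_mulC x z : x * x^* <= z * z^* -> `|x| <= `|z|.
Proof. by rewrite -!normCK ler_pXn2r // nnegrE. Qed.

Lemma stable_prod n F : stable n F ->
  exists c s, [/\ c != 0, size s = n, forall r, r \in s -> `|r| < 1 &
    F = c *: \prod_(r <- s) ('X - r%:P)].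
Proof.
move=> [sF nzF]; have [s defF] := closed_field_poly_normal F.
have F0 : F != 0 by rewrite -size_poly_eq0 sF.
have c0 : lead_coef F != 0 by rewrite lead_coef_eq0.
exists (lead_coef F), s; split=> //.
  by move: sF; rewrite defF size_scale // size_prod_XsubC => -[].
move=> r rs; rewrite real_ltNge ?normr_real ?real1 //; apply/negP => /nzF/negP; apply.
by rewrite -[_ == 0]/(root F r) defF rootZ // root_prod_XsubC.
Qed.

Lemma horner_scale_prod c s x :
  (c *: \prod_(r <- s) ('X - r%:P)).[x] = c * \prod_(r <- s) (x - r).
Proof.
rewrite hornerZ horner_prod; congr (_ * _).
by apply: eq_bigr => r _; rewrite hornerXsubC.
Qed.

Lemma coef_scale_prod c s : (c *: \prod_(r <- s) ('X - r%:P))`_(size s) = c.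
Proof.
have := monicP (monic_prod_XsubC s xpredT id).
by rewrite lead_coefE size_prod_XsubC coefZ => ->; rewrite mulr1.
Qed.

Lemma prod_const_seq T (s : seq T) x : \prod_(r <- s) x = x ^+ size s.
Proof.
by elim: s => [|a s IH]; rewrite ?big_nil ?big_cons ?IH ?exprS.
Qed.

Lemma size_poly_eqn n P : (size P <= n.+1)%N -> P`_n != 0 -> size P = n.+1.
Proof.
move=> sP Pn; apply/eqP; rewrite eqn_leq sP /=.
by rewrite ltnNge; apply: contra Pn => /leq_sizeP/(_ n (leqnn n))->.
Qed.

(** * Dilation *)

Lemma coef_dilate x F k : (dilate x F)`_k = x ^+ k * F`_k.
Proof.
rewrite /dilate coef_comp_poly.
under eq_bigr => i _ do rewrite exprZn coefZ coefXn mulrA.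
case: (ltnP k (size F)) => sk.
  rewrite (bigD1 (Ordinal sk)) //= eqxx mulr1 mulrC big1 ?addr0 // => i.
  by rewrite -val_eqE /= eq_sym => /negPf->; rewrite mulr0.
rewrite nth_default // mulr0 big1 // => i _.
by rewrite gtn_eqF ?mulr0 // (leq_trans (ltn_ord i) sk).
Qed.

(** Write $Rx - r = \frac{R+1}2 (x - r) + \frac{R-1}2 (x + r)$: the cross term of
    the squared modulus is a positive multiple of $|x|^2 - |r|^2$. *)
Lemma dilate_norm_gt R x r : 1 < R -> `|r| < `|x| ->
  (R + 1) / 2 * `|x - r| < `|R * x - r|.
Proof.
move=> R1 rx; have R0 : 0 < R by apply: lt_trans R1.
have cR : R^* = R by rewrite conj_Creal // gtr0_real.
have g0 : 0 < (R + 1) / 2 by rewrite divr_gt0 ?addr_gt0.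
rewrite -[X in X * _](gtr0_norm g0) -normrM; apply: ltr_norm_mulC.
rewrite !(rmorphM, rmorphB, rmorphD, rmorph1, fmorphV, rmorph_nat) /= cR.
rewrite -subr_gt0.
have -> : (R * x - r) * (R * x^* - r^*)
    - (R + 1) / 2 * (x - r) * ((R + 1) / 2 * (x^* - r^*))
   = ((R - 1) / 2) ^+ 2 * ((x + r) * (x + r)^*)
     + (R + 1) / 2 * (R - 1) * (x * x^* - r * r^*).
  by rewrite rmorphD /=; field.
apply: ltr_wpDl.
  by rewrite mulr_ge0 ?mul_conjC_ge0 // exprn_ge0 // divr_ge0 // subr_ge0 ltW.
rewrite mulr_gt0 ?(mulr_gt0 g0) ?subr_gt0 //.
by rewrite -!normCK ltr_pXn2r // nnegrE.
Qed.

(** Multiplying [dilate_norm_gt] over the zeros of $F$ gives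
    $|F(Rx)| > ((R+1)/2)^n |F(x)|$ outside the disc.  Strictness, hence $R > 1$
    and $n > 0$, is what allows equality in the bound on $d$. *)
Lemma stable_dilate n R d F : (0 < n)%N -> 1 < R -> `|d| <= ((R + 1) / 2) ^+ n ->
  stable n F -> stable n (dilate R F - d *: F).
Proof.
move=> n0 R1 dle stF; have [sF nzF] := stF.
have R0 : 0 < R by apply: lt_trans R1.
have g0 : 0 < (R + 1) / 2 by rewrite divr_gt0 ?addr_gt0.
split.
  apply: size_poly_eqn.
    apply/leq_sizeP => j nj; rewrite coefB coefZ coef_dilate.
    by rewrite nth_default ?sF // !mulr0 subrr.
  rewrite coefB coefZ coef_dilate -mulrBl mulf_neq0 //.
    rewrite subr_eq0; apply: contraTneq dle => <-.
    rewrite normrX (gtr0_norm R0) -real_ltNge ?gtr0_real ?exprn_gt0 //.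
    rewrite ltr_pXn2r ?nnegrE ?ltW // ltr_pdivrMr // mulr_natr mulr2n.
    by rewrite ltrD2l.
  have -> : F`_n = lead_coef F by rewrite lead_coefE sF.
  by rewrite lead_coef_eq0 -size_poly_eq0 sF.
move=> x x1; rewrite hornerD hornerN hornerZ horner_dilate subr_eq0.
apply/eqP => /(congr1 Num.norm); apply/eqP; rewrite gt_eqF //.
have Fx : 0 < `|F.[x]| by rewrite normr_gt0 nzF.
rewrite normrM; apply: le_lt_trans (ler_wpM2r (ltW Fx) dle) _.
have [c [s [c0 ss rs ->]]] := stable_prod stF.
rewrite !horner_scale_prod !normrM mulrCA ltr_pM2l ?normr_gt0 //.
rewrite -ss -prod_const_seq !normr_prod -big_split /= big_seq [ltRHS]big_seq.
apply: ltr_prod.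
  by rewrite -ss in n0; case: s n0 {ss rs} => //= a s _; rewrite mem_head.
move=> r /rs r1; rewrite mulr_ge0 ?(ltW g0) //=; apply: dilate_norm_gt => //.
exact: lt_le_trans x1.
Qed.

(** * Polar derivatives and Laguerre's theorem *)

(** The polar derivative of $F$, as a polynomial of degree $n$, with respect to
    the pole $A / B$, in homogeneous form so that the pole may be infinite: it
    sends $(x - r)^n$ to $n (x - r)^{n-1} (A - B r)$. *)
Definition polar n A B F := (n%:R * B) *: F + (A%:P - B *: 'X) * F^`().

Lemma horner_polar n A B F x :
  (polar n A B F).[x] = n%:R * B * F.[x] + (A - B * x) * F^`().[x].
Proof. by rewrite /polar !hornerE. Qed.

Lemma coef_polar n A B F k :
  (polar n A B F)`_k = (n%:R - k%:R) * B * F`_k + k.+1%:R * A * F`_k.+1.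
Proof.
rewrite /polar coefD coefZ mulrBl coefB coefCM -scalerAl coefZ mulrC.
rewrite [X in _ + (_ - _ * X)]coefXM !coef_deriv.
by case: k => [|k] /=; rewrite -?[F`_1 *+ _]mulr_natr -?[F`_k.+1 *+ _]mulr_natr
  -?[F`_k.+2 *+ _]mulr_natr; ring.
Qed.

(** The Moebius map $r \mapsto (A - Br)/(x - r)$ sends the open disc to a disc or a
    half plane that avoids $0$, since its zero $A/B$ is outside.  For $|x| > 1$ the
    factor [A^* * x - B^*] is, up to a positive multiple, the conjugate of the centre of
    the image, so it rotates that image into the right half plane. *)
Lemma mobius_half_plane A B x r : `|r| < 1 -> 1 <= `|x| -> `|B| <= `|A| ->
  A != B * x ->
  let w := (A^* * x - B^*) * ((A - B * r) / (x - r)) in 0 < w + w^*.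
Proof.
move=> r1 x1 BA ABx /=.
have xr : x - r != 0.
  by rewrite subr_eq0; apply: contraTneq x1 => ->; rewrite -real_ltNge ?normr_real ?real1.
have xr' : x^* - r^* != 0 by rewrite -rmorphB /= conjC_eq0.
set w := (w in 0 < w).
have -> : w = ((x * x^* - 1) * ((A - B * r) * (A - B * r)^*)
    + (A * A^* - B * B^*) * ((x - r) * (x - r)^*)
    + (A - B * x) * (A - B * x)^* * (1 - r * r^*)) / ((x - r) * (x - r)^*).
  rewrite /w !(rmorphM, rmorphB, fmorphV) /= !conjCK; field.
  by rewrite xr xr'.
rewrite -!normCK divr_gt0 ?exprn_gt0 ?normr_gt0 // ltr_wpDl //.
  rewrite addr_ge0 // mulr_ge0 ?exprn_ge0 // subr_ge0 ?ler_pXn2r ?nnegrE //.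
  by rewrite exprn_ege1.
by rewrite mulr_gt0 ?exprn_gt0 ?normr_gt0 ?subr_eq0 // subr_gt0 exprn_ilt1.
Qed.

Lemma deriv_prod_XsubC s x : x \notin s ->
  (\prod_(r <- s) ('X - r%:P))^`().[x]
  = \prod_(r <- s) (x - r) * \sum_(r <- s) (x - r)^-1.
Proof.
elim: s => [|a s IH]; first by rewrite !big_nil derivC horner0 mulr0.
rewrite inE negb_or => /andP[xa xs].
have xa0 : x - a != 0 by rewrite subr_eq0.
rewrite !big_cons derivM derivXsubC mul1r hornerD hornerM hornerXsubC IH //.
rewrite horner_prod.
under eq_bigr => r _ do rewrite hornerXsubC.
by rewrite mulrDr mulrAC mulfV // mul1r mulrA.
Qed.

(** Laguerre's theorem: at $|x| \ge 1$ the quotient of the polar derivative by $F$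
    is $\sum_i (A - B r_i)/(x - r_i)$, and by [mobius_half_plane] all the terms lie
    in a common open half plane. *)
Lemma stable_polar n A B F : A != 0 -> `|B| <= `|A| -> stable n.+1 F ->
  stable n (polar n.+1 A B F).
Proof.
move=> A0 BA stF; have [sF nzF] := stF.
have [c [s [c0 ss rs defF]]] := stable_prod stF.
split.
  apply: size_poly_eqn.
    apply/leq_sizeP => j nj; rewrite coef_polar [F`_j.+1]nth_default ?sF //.
    rewrite mulr0 addr0; case: (ltngtP n.+1 j) nj => // [nj|<-] _; last first.
      by rewrite subrr !mul0r.
    by rewrite nth_default ?mulr0 // sF.
  rewrite coef_polar; have -> : F`_n = - (c * \sum_(r <- s) r).
    by rewrite defF coefZ -[n]/(n.+1.-1) -ss coefPn_prod_XsubC ?ss // mulrN.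
  have -> : F`_n.+1 = c by rewrite defF -ss coef_scale_prod.
  set S := \sum_(r <- s) r.
  have -> : (n.+1%:R - n%:R) * B * - (c * S) + n.+1%:R * A * c
      = c * (n.+1%:R * A - B * S) by rewrite -natr1; ring.
  rewrite mulf_neq0 // subr_eq0; apply/eqP => eqS.
  have : `|S| < n.+1%:R.
    apply: le_lt_trans (ler_norm_sum _ _ _) _.
    rewrite -ss -sum1_size natr_sum big_seq [ltRHS]big_seq.
    apply: ltr_sum => [|r /rs //].
    by case: (s) ss => //= a t _; rewrite mem_head.
  rewrite -(ltr_pM2l (x := `|A|)) ?normr_gt0 // => /(le_lt_trans (ler_wpM2r (normr_ge0 S) BA)).
  by rewrite -normrM -eqS normrM normr_nat mulrC ltxx.
(* The case A = B x: x is the pole, where Laguerre's sum degenerates. *)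
move=> x x1; rewrite horner_polar; have [eqA|ABx] := eqVneq A (B * x).
  rewrite eqA subrr mul0r addr0 !mulf_neq0 ?nzF ?pnatr_eq0 //.
  by apply: contra_neq A0 => B0; rewrite eqA B0 mul0r.
have xs : x \notin s.
  by apply: contraL x1 => /rs; rewrite -real_ltNge ?normr_real ?real1.
have -> : n.+1%:R * B * F.[x] + (A - B * x) * F^`().[x]
    = F.[x] * \sum_(r <- s) (A - B * r) / (x - r).
  rewrite defF derivZ horner_scale_prod hornerZ deriv_prod_XsubC //.
  have -> : \sum_(r <- s) (A - B * r) / (x - r)
     = n.+1%:R * B + (A - B * x) * \sum_(r <- s) (x - r)^-1.
    rewrite -ss -sum1_size natr_sum mulr_suml mulr_sumr -big_split /=.
    apply: eq_big_seq => r rs'; rewrite mul1r; field.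
    by rewrite subr_eq0; apply: contraNneq xs => ->.
  ring.
rewrite mulf_neq0 ?nzF //; set S := \sum_(r <- s) _.
have : 0 < (A^* * x - B^*) * S + ((A^* * x - B^*) * S)^*.
  rewrite rmorphM /= rmorph_sum !mulr_sumr -big_split /=.
  case: s {defF xs S} ss rs => [//|a s] _ rs.
  have pos r : r \in a :: s -> 0 < (A^* * x - B^*) * ((A - B * r) / (x - r))
    + (A^* * x - B^*)^* * ((A - B * r) / (x - r))^*.
    by move=> /rs r1; rewrite -rmorphM; apply: mobius_half_plane.
  rewrite big_cons; apply: ltr_wpDr; last by rewrite pos ?mem_head.
  by rewrite big_seq sumr_ge0 // => r rs'; rewrite ltW // pos // inE rs' orbT.
by apply: contraTneq => ->; rewrite mulr0 conjC0 addr0 ltxx.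
Qed.

(** * The operator does not vanish on stable polynomials *)

Lemma horner_Bop n l0 l1 l2 F z : (Bop n l0 l1 l2 F).[z] =
  l0 * F.[z] + l1 * (n%:R / 2 * z * F^`().[z])
  + l2 * ((n%:R / 2 * z) ^+ 2 * (F^`()^`().[z] / 2)).
Proof.
rewrite /Bop derivSn derivn0 ?derivn1 !(hornerD, hornerZ, hornerM, horner_exp, hornerX).
have [-> ->] : 1`! = 1%N /\ 2`! = 2%N by [].
by rewrite invr1 mul1r [_^-1 * _]mulrC.
Qed.

(** One of the factors is constant when the quadratic is degenerate; keeping the
    factors homogeneous treats this case as a root at infinity. *)
Lemma quadratic_split (m0 m1 m2 : C) : exists p1 q1 p2 q2,
  [/\ m0 = p1 * p2, m1 = p1 * q2 + p2 * q1 & m2 = q1 * q2].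
Proof.
have [->|m20] := eqVneq m2 0.
  by exists m0, m1, 1, 0; rewrite !mulr0 mulr1 mul1r add0r.
pose u : {poly C} := m2 *: 'X^2 + (m1 *: 'X + m0%:P).
have su : size u != 1%N.
  rewrite size_polyDl size_scale // size_polyXn //.
  rewrite (leq_ltn_trans (size_polyD _ _)) // gtn_max.
  rewrite (leq_ltn_trans (size_scale_leq _ _)) ?size_polyX //.
  by rewrite (leq_ltn_trans (size_polyC_leq1 _)).
have [w] := closed_rootP _ su; rewrite /root !hornerE /= => /eqP uw.
exists (- w), 1, (m1 + m2 * w), m2; split; last by rewrite mul1r.
  by apply/eqP; rewrite -subr_eq0 -uw; apply/eqP; ring.
by ring.
Qed.

(** The root $-p_1/q_1$ of $u$ satisfies the half-plane condition, which survives
    clearing denominators; the nonvanishing holds because $u$ is not zero at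
    $n/2$. *)
Lemma half_plane_factor n l0 l1 l2 p1 q1 p2 q2 : (0 < n)%N ->
  (forall z, root (upoly n l0 l1 l2) z -> `|z| <= `|z - n%:R / 2|) ->
  l0 = p1 * p2 -> 'C(n, 1)%:R * l1 = p1 * q2 + p2 * q1 ->
  'C(n, 2)%:R * l2 = q1 * q2 ->
  `|p1| <= `|p1 + q1 * (n%:R / 2)| /\ p1 + q1 * (n%:R / 2) != 0.
Proof.
move=> n0 hu e0 e1 e2.
have n2 : n%:R / 2 != 0 :> C by rewrite mulf_neq0 ?invr_eq0 ?pnatr_eq0 -?lt0n.
have uE z : (upoly n l0 l1 l2).[z] = (p1 + q1 * z) * (p2 + q2 * z).
  by rewrite /upoly !hornerE /= e0 e1 e2; ring.
have le1 : `|p1| <= `|p1 + q1 * (n%:R / 2)|.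
  have [->|q10] := eqVneq q1 0; first by rewrite mul0r addr0.
  have := hu (- p1 / q1); rewrite /root uE => /(_ _).
  have -> : p1 + q1 * (- p1 / q1) = 0 by field.
  rewrite mul0r eqxx => /(_ isT).
  rewrite -(ler_pM2l (x := `|q1|)) ?normr_gt0 // -!normrM.
  have -> : q1 * (- p1 / q1) = - p1 by field.
  have -> : q1 * (- p1 / q1 - n%:R / 2) = - (p1 + q1 * (n%:R / 2)) by field.
  by rewrite !normrN.
split=> //; apply/eqP => e; move: le1; rewrite e normr0 normr_le0 => /eqP p10.
move/eqP: e; rewrite p10 add0r mulf_eq0 (negPf n2) orbF => /eqP q10.
have := hu (n%:R / 2); rewrite /root uE p10 q10 mul0r addr0 mul0r eqxx subrr normr0.
by move=> /(_ isT); rewrite normr_le0 (negPf n2).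
Qed.

(** On $F = (x - r)^n$ the operator gives $(z-r)^n u(\frac n2 \frac z{z-r})$, and the
    factor $p + q w$ of $u$ turns into $(A - p r)/(z - r)$ with
    $A = z (p + q n/2)$; so it acts as the polar derivative with pole $A / p$. *)
Lemma Bop_stable_neq0 n l0 l1 l2 F z : (0 < n)%N ->
  (forall w, root (upoly n l0 l1 l2) w -> `|w| <= `|w - n%:R / 2|) ->
  stable n F -> 1 <= `|z| -> (Bop n l0 l1 l2 F).[z] != 0.
Proof.
move=> n0 hu stF z1.
have z0 : z != 0 by rewrite -normr_gt0 (lt_le_trans _ z1).
pose A n p q : C := z * (p + q * (n%:R / 2)).
have Apos m p q : `|p| <= `|p + q * (m%:R / 2)| /\ p + q * (m%:R / 2) != 0 ->
    `|p| <= `|A m p q| /\ A m p q != 0.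
  move=> [le nz]; split; last by rewrite mulf_neq0.
  by rewrite normrM (le_trans le) // ler_peMl.
have subA m p q : A m p q - p * z = m%:R / 2 * z * q by rewrite /A; ring.
case: n n0 hu stF => // -[|n] n0 hu stF.
  (* In degree 1 the second derivative vanishes and one polar derivative is enough. *)
  have [sF _] := stF.
  have e1 : 'C(1, 1)%:R * l1 = l0 * 0 + 1 * l1 by rewrite mulr0 add0r bin1.
  have e2 : 'C(1, 2)%:R * l2 = l1 * 0 by rewrite bin_small // mul0r mulr0.
  have le_nz := half_plane_factor n0 hu (esym (mulr1 l0)) e1 e2.
  have [le' nz'] := Apos _ _ _ le_nz.
  have [_ /(_ z z1)] := stable_polar nz' le' stF.
  rewrite horner_polar subA horner_Bop.
  have /size_poly_leq0P -> : (size F^`()^`() <= 0)%N.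
    apply/leq_sizeP => j _; rewrite !coef_deriv nth_default ?mul0rn //.
    by rewrite sF.
  by rewrite horner0 mul0r !mulr0 addr0 !mul1r (mulrC l1) mulrAC.
have [p1 [q1 [p2 [q2 [e0 e1 e2]]]]] :=
  quadratic_split l0 ('C(n.+2, 1)%:R * l1) ('C(n.+2, 2)%:R * l2).
have [le1 nz1] := Apos _ _ _ (half_plane_factor n0 hu e0 e1 e2).
rewrite mulrC in e0; rewrite [RHS]addrC in e1; rewrite [RHS]mulrC in e2.
have [le2 nz2] := Apos _ _ _ (half_plane_factor n0 hu e0 e1 e2).
have [_ /(_ z z1)] := stable_polar nz2 le2 (stable_polar nz1 le1 stF).
apply: contraNneq; rewrite horner_polar subA horner_polar subA horner_Bop => B0.
have -> : (polar n.+2 (A n.+2 p1 q1) p1 F)^`().[z] =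
  n.+1%:R * p1 * F^`().[z] + n.+2%:R / 2 * z * q1 * F^`()^`().[z].
  rewrite /polar derivD derivM derivB derivC !derivZ derivX !hornerE /=.
  rewrite -(subA n.+2 p1 q1) -[n.+2%:R]natr1; ring.
have bin2E : 'C(n.+2, 2)%:R = n.+2%:R * n.+1%:R / 2 :> C.
  apply: (mulIf (x := 2)); first by rewrite pnatr_eq0.
  by rewrite divfK ?pnatr_eq0 // -!natrM mulnC -mul_bin_diag bin1.
rewrite bin2E in e2; rewrite bin1 in e1.
set f0 := F.[z] in B0 *; set f1 := F^`().[z] in B0 *.
set f2 := F^`()^`().[z] in B0 *.
apply/eqP; transitivity (n.+2%:R * n.+1%:R * (p2 * p1) * f0
  + n.+1%:R / 2 * z * f1 * n.+2%:R * (p2 * q1 + p1 * q2)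
  + (n.+2%:R / 2 * z) ^+ 2 * f2 * (q2 * q1)); first by ring.
rewrite -e0 -e1 -e2 -(mulr0 (n.+2%:R * n.+1%:R)) -B0; by field.
Qed.

(** * The reciprocal polynomial *)

Lemma coef_conj_recip n P k :
  (conj_recip n P)`_k = if (k <= n)%N then (P`_(n - k))^* else 0.
Proof.
rewrite coef_sum; under eq_bigr => i _ do rewrite coefZ coefXn.
case: ifPn => kn.
  have nk : (n - k < n.+1)%N by rewrite ltnS leq_subr.
  rewrite (bigD1 (Ordinal nk)) //= subKn // eqxx mulr1 big1 ?addr0 // => i.
  rewrite -val_eqE /= => ik; rewrite (negPf (_ : k != _)) ?mulr0 //.
  by apply: contraNneq ik => ->; rewrite subKn // -ltnS.
rewrite big1 // => i _; rewrite gtn_eqF ?mulr0 //.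
by rewrite (leq_ltn_trans (leq_subr _ _)) // ltnNge.
Qed.

Lemma size_conj_recip n P : (size (conj_recip n P) <= n.+1)%N.
Proof.
by apply/leq_sizeP => j nj; rewrite coef_conj_recip leqNgt nj.
Qed.

Lemma conj_recipK n P : (size P <= n.+1)%N -> conj_recip n (conj_recip n P) = P.
Proof.
move=> sP; apply/polyP => k; rewrite !coef_conj_recip leq_subr.
case: ifPn => kn; first by rewrite subKn // conjCK.
by rewrite nth_default // (leq_trans sP) // ltnNge.
Qed.

Lemma conj_recip_shift n P z : conj_recip n (P + z%:P) = conj_recip n P + z^* *: 'X^n.
Proof.
apply/polyP => k; rewrite coefD coefZ coefXn !coef_conj_recip coefD coefC rmorphD /=.
case: ifPn => kn.
  by rewrite subn_eq0 eqn_leq kn /=; case: leqP; rewrite ?mulr1 ?mulr0 ?conjC0.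
by rewrite add0r gtn_eqF ?mulr0 // ltnNge.
Qed.

Lemma reflect_norm_le x r : `|r| < 1 -> 1 <= `|x| -> `|1 - x * r^*| <= `|x - r|.
Proof.
move=> r1 x1; apply: ler_norm_mulC; rewrite !(rmorphB, rmorphM, rmorph1) /= conjCK.
rewrite -subr_ge0.
have -> : (x - r) * (x^* - r^*) - (1 - x * r^*) * (1 - x^* * r)
   = (x * x^* - 1) * (1 - r * r^*) by ring.
by rewrite -!normCK mulr_ge0 // subr_ge0 ?exprn_ege1 // exprn_ile1 // ltW.
Qed.

(** The zeros of the reciprocal are the reflections of those of $H$ in the circle,
    so [reflect_norm_le] compares the two products factor by factor. *)
Lemma norm_conj_recip_le n H x : stable n H -> 1 <= `|x| ->
  `|(conj_recip n H).[x]| <= `|H.[x]|.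
Proof.
move=> stH x1; have x0 : x != 0 by rewrite -normr_gt0 (lt_le_trans _ x1).
have [sH _] := stH; rewrite horner_conj_recip ?sH //.
have [c [s [c0 ss rs ->]]] := stable_prod stH.
rewrite !horner_scale_prod normrM norm_conjC !normrM mulrCA.
rewrite ler_pM2l ?normr_gt0 // -ss -prod_const_seq !normr_prod -big_split /=.
rewrite big_seq [leRHS]big_seq; apply: ler_prod => r /rs r1.
rewrite mulr_ge0 //=.
have -> : `|(x^*)^-1 - r| = `|x^-1 - r^*|.
  by rewrite -norm_conjC rmorphB /= fmorphV /= conjCK.
by rewrite -normrM mulrBr mulfV // reflect_norm_le.
Qed.

(** The dominant term $vH$ excludes zeros outside the disc, and it also dominates
    the leading coefficient, since the constant term of a stable polynomial is at
    most its leading coefficient in modulus; so the degree stays $n$. *)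
Lemma stable_recip_sub n H v : stable n H -> 1 < `|v| ->
  stable n (conj_recip n H - v *: H).
Proof.
move=> stH v1; have [sH nzH] := stH; split.
  apply: size_poly_eqn.
    rewrite (leq_trans (size_polyD _ _)) // geq_max size_conj_recip size_polyN.
    by rewrite (leq_trans (size_scale_leq _ _)) ?sH.
  have [c [s [c0 ss rs defH]]] := stable_prod stH.
  rewrite coefB coef_conj_recip leqnn subnn coefZ.
  have -> : H`_n = c by rewrite defH -ss coef_scale_prod.
  rewrite -horner_coef0 defH horner_scale_prod.
  rewrite subr_eq0; apply/eqP => /(congr1 Num.norm); apply/eqP; rewrite lt_eqF //.
  rewrite norm_conjC normrM mulrC normrM ltr_pM2r ?normr_gt0 //.
  apply: le_lt_trans v1; rewrite normr_prod.
  rewrite [leRHS](_ : 1 = \prod_(r <- s) 1); last by rewrite big1.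
  rewrite big_seq [leRHS]big_seq; apply: ler_prod => r /rs r1.
  by rewrite normr_ge0 sub0r normrN ltW.
move=> x x1; rewrite hornerD hornerN hornerZ subr_eq0.
apply/eqP => /(congr1 Num.norm); apply/eqP; rewrite lt_eqF //.
apply: le_lt_trans (norm_conj_recip_le stH x1) _.
by rewrite normrM ltr_pMl // normr_gt0 nzH.
Qed.

Lemma size_add_const_le n P v : (size P <= n.+1)%N -> (size (P + v%:P)%R <= n.+1)%N.
Proof.
move=> sP; rewrite (leq_trans (size_polyD _ _)) // geq_max sP.
by rewrite (leq_trans (size_polyC_leq1 _)).
Qed.

Lemma stable_recip_shift n P M v : (size P <= n.+1)%N ->
  (forall x, `|x| <= 1 -> `|P.[x]| <= M) -> M < `|v| ->
  stable n (conj_recip n (P + v%:P)).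
Proof.
move=> sP PM Mv; have nz x : `|x| <= 1 -> (P + v%:P).[x] != 0.
  move=> x1; rewrite hornerD hornerC addr_eq0; apply/eqP => /(congr1 Num.norm).
  apply/eqP; rewrite normrN lt_eqF //; exact: le_lt_trans (PM x x1) Mv.
have sPv := size_add_const_le v sP.
split.
  apply: size_poly_eqn (size_conj_recip _ _) _.
  rewrite coef_conj_recip leqnn subnn conjC_eq0 -horner_coef0 nz //.
  by rewrite normr0.
move=> x x1; have x0 : x != 0 by rewrite -normr_gt0 (lt_le_trans _ x1).
rewrite horner_conj_recip // mulf_neq0 ?expf_neq0 // conjC_eq0 nz //.
by rewrite normfV norm_conjC invf_le1 // (lt_le_trans _ x1).
Qed.

(** * Functionals that do not vanish on stable polynomials *)

(** The core of the argument, described at the top: $L$ is tested on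
    $H = Q + \bar v z^n$ and on $P + v - uH$ with $|v| > M$ and $|u| > 1$. *)
Lemma scalar_stable_bound n (L : {scalar {poly C}}) P M :
  (forall F, stable n F -> L F != 0) -> (size P <= n.+1)%N -> 0 <= M ->
  (forall x, `|x| <= 1 -> `|P.[x]| <= M) ->
  `|L P| + `|L (conj_recip n P)| <= (`|L 'X^n| + `|L 1|) * M.
Proof.
move=> Lnz sP M0 PM; set Q := conj_recip n P.
have LH v : M < `|v| -> L Q + v^* * L 'X^n != 0.
  move=> Mv; rewrite -linearZ -linearD -conj_recip_shift; apply: Lnz.
  exact: stable_recip_shift sP PM Mv.
have LG v : M < `|v| -> `|L P + v * L 1| <= `|L Q + v^* * L 'X^n|.
  move=> Mv; rewrite real_leNgt ?normr_real //; apply/negP.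
  set q := L Q + _; set p := L P + _ => qp.
  have q0 : q != 0 by apply: LH.
  have v1 : 1 < `|p / q| by rewrite normf_div ltr_pdivlMr ?mul1r ?normr_gt0.
  have := Lnz _ (stable_recip_sub (stable_recip_shift sP PM Mv) v1).
  rewrite conj_recipK ?size_add_const_le //.
  rewrite linearB linearZ conj_recip_shift !linearD linearZ /= -/q.
  by rewrite -[v%:P]mulr1 mul_polyC linearZ /= -/p divfK // subrr eqxx.
have Xn0 : L 'X^n != 0.
  apply: Lnz; split; first by rewrite size_polyXn.
  by move=> x x1; rewrite hornerXn expf_neq0 // -normr_gt0 (lt_le_trans _ x1).
set p := L P; set q := L Q in LH LG *; set t := L 'X^n in Xn0 LH LG *.
set e := L 1 in LG *.
(* Otherwise v could be chosen so that L vanishes on H. *)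
have qt : `|q| <= M * `|t|.
  rewrite real_leNgt ?realM ?normr_real ?ger0_real //; apply/negP => Mq.
  have := LH (- (q / t)^*); rewrite normrN norm_conjC normf_div ltr_pdivlMr ?normr_gt0 //.
  by rewrite rmorphN /= conjCK mulNr divfK // subrr eqxx => /(_ Mq).
have LPQ v : M < v -> `|p| + `|q| <= (`|t| + `|e|) * v.
  move=> Mv; have v0 : 0 < v by apply: le_lt_trans Mv.
  (* This argument makes the two terms of L H point in opposite directions. *)
  have [u u1 eu] : exists2 u : C, `|u| = 1 & `|q + v * u * t| = v * `|t| - `|q|.
    have [q0|q0] := eqVneq q 0.
      exists 1; rewrite ?normr1 // q0 add0r mulr1 normrM normr0 subr0.
      by rewrite (gtr0_norm v0).
    exists (- (q / `|q|) / (t / `|t|)).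
      by rewrite normf_div normrN !normf_div !normr_id !mulfV ?invr1 ?normr_eq0 // divr1.
    have -> : q + v * (- (q / `|q|) / (t / `|t|)) * t
       = (`|q| - v * `|t|) * (q / `|q|).
      by field; apply/and3P; split; rewrite ?normr_eq0.
    rewrite normrM normf_div normr_id mulfV ?normr_eq0 // mulr1 distrC ger0_norm //.
    by rewrite subr_ge0 (le_trans qt) // ler_wpM2r // ltW.
  have nvu : `|(v * u)^*| = v by rewrite norm_conjC normrM u1 mulr1 gtr0_norm.
  have := LG (v * u)^*; rewrite nvu conjCK eu => /(_ Mv) le1.
  have le2 : `|p| <= `|p + (v * u)^* * e| + v * `|e|.
    rewrite -[X in `|X| <= _](addrK ((v * u)^* * e)).
    rewrite (_ : v * `|e| = `|(v * u)^* * e|); last by rewrite normrM nvu.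
    exact: ler_normB.
  have -> : (`|t| + `|e|) * v = v * `|t| - `|q| + v * `|e| + `|q| by ring.
  by rewrite lerD2r (le_trans le2) // lerD2r.
apply/ler_addgt0Pr => d d0; set E := `|t| + `|e| in LPQ *.
have E0 : 0 < E by rewrite ltr_wpDr // normr_gt0.
have := LPQ (M + d / E); rewrite ltrDl divr_gt0 // => /(_ isT).
by rewrite mulrDr mulrCA mulfV ?gt_eqF // mulr1.
Qed.

(** * The functional of the theorem *)

Definition dilate_eval n l0 l1 l2 R d z F : C :=
  (Bop n l0 l1 l2 (dilate R F - d *: F)).[z].

Lemma dilate_eval_is_scalar n l0 l1 l2 R d z :
  GRing.linear_for *%R (dilate_eval n l0 l1 l2 R d z).
Proof.
move=> k p q; rewrite /dilate_eval !horner_Bop.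
have -> : dilate R (k *: p + q) - d *: (k *: p + q)
   = k *: (dilate R p - d *: p) + (dilate R q - d *: q).
  rewrite /dilate comp_polyD comp_polyZ scalerBr !scalerDr !scalerA [k * d]mulrC opprD.
  by rewrite addrACA.
move: (dilate R p - _) (dilate R q - _) => p' q'.
rewrite !(derivD, derivZ, hornerD, hornerZ); ring.
Qed.

HB.instance Definition _ n l0 l1 l2 R d z := GRing.isLinear.Build C {poly C} C *%R
  (dilate_eval n l0 l1 l2 R d z) (dilate_eval_is_scalar n l0 l1 l2 R d z).

Lemma dilate_evalE n l0 l1 l2 R d z F : dilate_eval n l0 l1 l2 R d z F
  = (Bop n l0 l1 l2 (dilate R F)).[z] - d * (Bop n l0 l1 l2 F).[z].
Proof.
rewrite /dilate_eval !horner_Bop !(derivB, derivZ, hornerD, hornerN, hornerZ); ring.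
Qed.

Lemma dilate_eval_Xn n l0 l1 l2 R d z : dilate_eval n l0 l1 l2 R d z 'X^n
  = (R ^+ n - d) * (Bop n l0 l1 l2 'X^n).[z].
Proof.
rewrite /dilate_eval; have -> : dilate R 'X^n - d *: 'X^n = (R ^+ n - d) *: 'X^n.
  by rewrite /dilate comp_Xn_poly exprZn scalerBl.
rewrite !horner_Bop !derivZ !hornerZ; ring.
Qed.

Lemma dilate_eval_1 n l0 l1 l2 R d z : dilate_eval n l0 l1 l2 R d z 1 = (1 - d) * l0.
Proof.
rewrite dilate_evalE /dilate comp_polyC !horner_Bop derivC deriv0 horner0 hornerC.
ring.
Qed.

(** * Maximum modulus principle for polynomials *)

Lemma prim_root_exists n : exists w : C, n.+1.-primitive_root w.
Proof.
have [s defX] := closed_field_poly_normal ('X^(n.+1) - 1 : {poly C}).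
rewrite (monicP _) ?monicXnsubC // scale1r in defX.
have s1 : all n.+1.-unity_root s by apply/allP => w; rewrite -root_prod_XsubC -defX.
have ss : (n.+1 <= size s)%N.
  by rewrite -ltnS -(size_prod_XsubC s id) -defX size_XnsubC.
have [|w _ pw] := hasP (cyclic.has_prim_root (ltn0Sn n) s1 _ ss); last by exists w.
by rewrite -separable.separable_prod_XsubC -defX cyclotomic.separable_Xn_sub_1 // pnatr_eq0.
Qed.

(** The exponent $j (n + 1 - k)$ stands for $-jk$, as $w^{n+1} = 1$. *)
Lemma coef_circle_mean n w P k : n.+1.-primitive_root w -> (size P <= n.+1)%N ->
  (k <= n)%N -> \sum_(j < n.+1) P.[w ^+ j] * w ^+ (j * (n.+1 - k)) = n.+1%:R * P`_k.
Proof.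
move=> pw sP kn.
under eq_bigr => j _ do rewrite (horner_coef_wide _ sP) mulr_suml.
rewrite exchange_big /= (bigD1 (Ordinal (kn : (k < n.+1)%N))) //= [X in _ + X]big1.
  rewrite addr0 -[n.+1 in RHS]card_ord -sum1_card natr_sum mulr_suml.
  apply: eq_bigr => j _; rewrite -mulrA -exprM -exprD -mulnDr subnKC 1?ltnW //.
  by rewrite mulnC exprM (prim_expr_order pw) expr1n mulr1 mul1r.
move=> i ik; pose y := w ^+ (i + (n.+1 - k)).
under eq_bigr => j _ do
  rewrite -mulrA -exprM -exprD -mulnDr mulnC exprM.
rewrite -mulr_sumr -/y; have [|y1] := eqVneq y 1.
  move/eqP; rewrite -(prim_order_dvd pw) => /dvdnP[q].
  have := ltn_ord i; rewrite ltnS => iln e.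
  suff eik : (i == k :> nat) by case/negP: ik; rewrite -val_eqE.
  have q1 : q = 1%N.
    case: q e => [|[|q]] //; rewrite ?mul0n ?mulSn; lia.
  by move: e; rewrite q1 mul1n; lia.
suff -> : \sum_(j < n.+1) y ^+ j = 0 by rewrite mulr0.
apply: (mulfI (x := y - 1)); first by rewrite subr_eq0.
by rewrite -subrX1 mulr0 -exprM mulnC exprM (prim_expr_order pw) expr1n subrr.
Qed.

(** Each coefficient is a mean of values on the circle, weighted by unimodular
    numbers, so it is at most $M$.  The factor $n + 1$ lost here is harmless: it
    grows only linearly when the bound is applied to the powers of $P$. *)
Lemma norm_horner_disc_le n P M x : (size P <= n.+1)%N ->
  (forall w, `|w| = 1 -> `|P.[w]| <= M) -> `|x| <= 1 -> `|P.[x]| <= n.+1%:R * M.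
Proof.
move=> sP PM x1; have [w pw] := prim_root_exists n.
have w1 : `|w| = 1.
  by apply/eqP; rewrite -(pexpr_eq1 (n := n.+1)) // -normrX (prim_expr_order pw) normr1.
have w1n m : `|w ^+ m| = 1 by rewrite normrX w1 expr1n.
have cM k : (k < n.+1)%N -> `|P`_k| <= M.
  move=> kn; rewrite -(ler_pM2l (x := n.+1%:R)) ?ltr0Sn //.
  rewrite -[X in X * `|_|](normr_nat C) -normrM -(coef_circle_mean pw sP kn).
  rewrite (le_trans (ler_norm_sum _ _ _)) // mulr_natl -[n.+1 in leRHS]card_ord -sumr_const.
  by apply: ler_sum => j _; rewrite normrM w1n mulr1 PM.
rewrite (horner_coef_wide _ sP) (le_trans (ler_norm_sum _ _ _)) //.
rewrite mulr_natl -[n.+1 in leRHS]card_ord -sumr_const.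
apply: ler_sum => j _; rewrite normrM normrX.
by rewrite (le_trans _ (cM j _)) // ler_piMr // exprn_ile1.
Qed.

End Stable.

(** A geometric sequence of ratio $y/M > 1$ outgrows any linear one; at exponent
    $2m$, Bernoulli's inequality squared already gives quadratic growth. *)
Lemma le_of_expr_le (K : realType) (n : nat) (y M : K) : 0 <= y -> 0 <= M ->
  (forall m, y ^+ m <= (n * m).+1%:R * M ^+ m) -> y <= M.
Proof.
move=> y0 M0 yM; rewrite leNgt; apply/negP => My.
have [M00|Mn0] := eqVneq M 0.
  by have := yM 1%N; rewrite !expr1 M00 mulr0 leNgt -{1}M00 My.
have Mp : 0 < M by rewrite lt_neqAle eq_sym Mn0.
pose d := y / M - 1; have d0 : 0 < d by rewrite subr_gt0 ltr_pdivlMr // mul1r.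
have bern m : 1 + m%:R * d <= (y / M) ^+ m.
  elim: m => [|m IH]; first by rewrite mul0r addr0.
  have yMd : y / M = 1 + d by rewrite /d addrC subrK.
  rewrite yMd in IH *; rewrite exprS (le_trans _ (ler_wpM2l _ IH)) //; last first.
    by rewrite addr_ge0 ?ltW.
  rewrite -[m.+1%:R]natr1 -subr_ge0.
  have -> : (1 + d) * (1 + m%:R * d) - (1 + (m%:R + 1) * d) = m%:R * d ^+ 2 by ring.
  by rewrite mulr_ge0 ?exprn_ge0 // ltW.
pose m := (Num.truncn (2 * n%:R / d ^+ 2)).+1.
have md : 2 * n%:R < m%:R * d ^+ 2.
  by rewrite -ltr_pdivrMr ?exprn_gt0 // truncnS_gt.
have := yM (m + m)%N; rewrite -ler_pdivrMr ?exprn_gt0 // -expr_div_n exprD.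
apply/negP; rewrite -ltNge.
have b0 : 0 <= 1 + m%:R * d by rewrite addr_ge0 ?mulr_ge0 // ltW.
apply: lt_le_trans (ler_pM b0 b0 (bern m) (bern m)).
rewrite -natr1 natrM natrD -subr_gt0.
have -> : (1 + m%:R * d) * (1 + m%:R * d) - (n%:R * (m%:R + m%:R) + 1)
   = m%:R * d *+ 2 + m%:R * (m%:R * d ^+ 2 - 2 * n%:R) by ring.
have m0 : 0 < m%:R :> K by rewrite ltr0n.
have p1 := mulr_gt0 m0 d0.
have p2 : 0 < m%:R * (m%:R * d ^+ 2 - 2 * n%:R) by rewrite mulr_gt0 ?subr_gt0.
by rewrite addr_gt0 // mulr2n addr_gt0.
Qed.

(** [norm_horner_disc_le] for $P^m$ gives $|P(x)|^m \le (nm + 1) M^m$ for every $m$,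
    and [le_of_expr_le] removes the linear factor. *)
Lemma max_modulus_disc (K : realType) (P : {poly K[i]}) (x : K[i]) : `|x| <= 1 ->
  `|P.[x]| <= (circle_max P)%:C.
Proof.
move=> x1; have normcE (w : K[i]) : `|w| = (Normc.normc w)%:C by case: w.
have M0 : 0 <= circle_max P.
  rewrite -lecR; apply: (@le_trans _ _ `|P.[1]|); first exact: normr_ge0.
  by rewrite normcE lecR circle_max_ub ?normr1.
rewrite normcE lecR; apply: (@le_of_expr_le _ (size P).-1) => // [|m].
  by rewrite -lecR -normcE; exact: normr_ge0.
rewrite -lecR rmorphM !rmorphXn /= rmorph_nat -normcE -normrX -horner_exp.
apply: norm_horner_disc_le x1.
  by rewrite (leq_trans (size_exp_leq _ _)).
move=> w w1; rewrite horner_exp normrX lerXn2r ?nnegrE //.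
  by rewrite lecR.
by rewrite normcE lecR circle_max_ub.
Qed.

(** * The theorem *)

Lemma dilate_eval_stable_neq0 (C : numClosedFieldType) n (l0 l1 l2 R d z : C) :
  (0 < n)%N ->
  (forall w, root (upoly n l0 l1 l2) w -> `|w| <= `|w - n%:R / 2|) ->
  1 <= `|z| -> 1 < R -> `|d| <= ((R + 1) / 2) ^+ n ->
  forall F, stable n F -> dilate_eval n l0 l1 l2 R d z F != 0.
Proof.
move=> n0 hu z1 R1 dR F stF; apply: Bop_stable_neq0 => //.
exact: stable_dilate.
Qed.

Lemma norm_coef_le (C : numClosedFieldType) (a b g : C) :
  `|a| <= 1 -> `|b| <= 1 -> 1 <= g -> `|a - b * (g - `|a|)| <= g.
Proof.
move=> a1 b1 g1; have ag : 0 <= g - `|a| by rewrite subr_ge0 (le_trans a1).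
rewrite (le_trans (ler_normB _ _)) // normrM (ger0_norm ag) -lerBrDl.
by rewrite ler_piMl.
Qed.

Theorem theorem2 (K : realType) (n : nat) (l0 l1 l2 : K[i])
    (hn : (1 <= n)%N)
    (hu : forall z : K[i], root (upoly n l0 l1 l2) z -> `|z| <= `|z - n%:R / 2|)
    (P : {poly K[i]}) (hP : size P = n.+1)
    (a b : K[i]) (ha : `|a| <= 1) (hb : `|b| <= 1)
    (R : K) (hR : 1 <= R) (z : K[i]) (hz : 1 <= `|z|) :
  let B := Bop n l0 l1 l2 in
  let Q := conj_recip n P in
  let c : K[i] := b * (((R%:C + 1) / 2) ^+ n - `|a|) in
  `|(B (dilate R%:C P)).[z] - a * (B P).[z] + c * (B P).[z]|
    + `|(B (dilate R%:C Q)).[z] - a * (B Q).[z] + c * (B Q).[z]|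
  <= (`|R%:C ^+ n - a + c| * `|(B 'X^n).[z]| + `|1 - a + c| * `|l0|)
       * (circle_max P)%:C.
Proof.
cbv zeta; set B := Bop n l0 l1 l2; set Q := conj_recip n P.
set c : K[i] := b * _.
have PM x : `|x| <= 1 -> `|P.[x]| <= (circle_max P)%:C by exact: max_modulus_disc.
have M0 : 0 <= (circle_max P)%:C by apply: le_trans (PM 0 _); rewrite ?normr0.
have sP : (size P <= n.+1)%N by rewrite hP.
have bound r d : (forall F, stable n F -> dilate_eval n l0 l1 l2 r d z F != 0) ->
    `|dilate_eval n l0 l1 l2 r d z P| + `|dilate_eval n l0 l1 l2 r d z Q|
    <= (`|r ^+ n - d| * `|(B 'X^n).[z]| + `|1 - d| * `|l0|) * (circle_max P)%:C.
  move=> /scalar_stable_bound /(_ sP M0 PM).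
  by rewrite /= dilate_eval_Xn dilate_eval_1 !normrM.
have eE F : (B (dilate R%:C F)).[z] - a * (B F).[z] + c * (B F).[z]
    = dilate_eval n l0 l1 l2 R%:C (a - c) z F.
  by rewrite dilate_evalE mulrBl opprB addrA addrAC.
have subE r : r - a + c = r - (a - c) by ring.
rewrite !eE !subE.
(* The dilation estimate is strict only for R > 1. *)
move: hR; rewrite le_eqVlt => /orP[/eqP R1|R1]; last first.
  apply: bound => F; apply: dilate_eval_stable_neq0 => //.
    by rewrite -ltcR in R1.
  apply: norm_coef_le => //; rewrite exprn_ege1 // ler_pdivlMr // mul1r.
  by rewrite -[2]/(1 + 1) lerD2r -[1]/(1%:C) lecR ltW.
have stable0 : forall F, stable n F -> dilate_eval n l0 l1 l2 1 0 z F != 0.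
  move=> F stF; rewrite dilate_evalE mul0r subr0 /dilate scale1r comp_polyXr.
  exact: Bop_stable_neq0.
have split1 F : dilate_eval n l0 l1 l2 R%:C (a - c) z F
   = (1 - (a - c)) * dilate_eval n l0 l1 l2 1 0 z F.
  by rewrite !dilate_evalE -R1 /dilate scale1r comp_polyXr; ring.
rewrite !split1 -R1 !normrM -mulrDr.
have := bound _ _ stable0; rewrite !expr1n subr0 normr1 !mul1r => le1.
apply: le_trans (ler_wpM2l (normr_ge0 _) le1) _.
by rewrite mulrA mulrDr.
Qed.
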